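(* Let $n\ge 1$, let $S=\begin{pmatrix} A & B\\ C & D\end{pmatrix}\in SP_{2n}(\mathbb{C})$ (with $n\times n$ blocks) and let $Z\in\mathcal{S}_n$. If $i(S^*JS-J)\ge 0$, then $\Phi_S(Z)=(AZ+B)(CZ+D)^{-1}\in\mathcal{S}_n$.
   Context: $J=\begin{pmatrix} O & I_n\\ -I_n & O\end{pmatrix}$, where $I_n$ and $O$ are the $n\times n$ identity and zero matrices. $SP_{2n}(\mathbb{C})$ is the group of complex $2n\times 2n$ matrices $S$ with $S^tJS=J$ (transpose, not conjugate transpose). $S^*$ is the conjugate transpose of $S$, and for a Hermitian matrix $M$, $M\ge 0$ means positive semidefinite (the matrix $i(S^*JS-J)$ is Hermitian). $\mathcal{S}_n$ (the Siegel upper half space) is the set of complex $n\times n$ matrices $Z=X+iY$ with $X,Y$ real symmetric and $Y$ positive definite. The map $\Phi_S$ is well defined at $Z$ when $CZ+D$ is invertible; the conclusion $\Phi_S(Z)\in\mathcal{S}_n$ includes this invertibility. *)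

(* Defs.v *)
From HB Require Import structures.
From mathcomp Require Import all_boot all_order all_algebra.
From mathcomp Require Import complex.
From mathcomp Require Import reals.

Set Implicit Arguments.
Unset Strict Implicit.
Unset Printing Implicit Defensive.

Import Order.TTheory GRing.Theory Num.Theory.
Local Open Scope ring_scope.
Local Open Scope sesquilinear_scope.

(* The field of complex numbers is R[i] for R : realType; [M ^t*] is the
   conjugate transpose and [M^T] the plain transpose. *)

Definition symplectic_J (K : pzRingType) (n : nat) : 'M[K]_(n + n) :=
  block_mx 0 1%:M (- 1%:M) 0.

(* Plain transpose, not [^t*], also over the complex numbers. *)
Definition symplectic (K : pzRingType) (n : nat) (S : 'M[K]_(n + n)) : Prop :=
  S^T *m symplectic_J K n *m S = symplectic_J K n.

(* The order on R[i] compares only numbers with the same imaginary part, so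
   [0 <= z] says that z is real and nonnegative. *)
Definition hermitian_psd (R : realType) (m : nat) (M : 'M[R[i]]_m) : Prop :=
  M \is hermsymmx /\ forall v : 'cV[R[i]]_m, 0 <= (v ^t* *m M *m v) 0 0.

Definition real_posdef (R : realType) (n : nat) (Y : 'M[R]_n) : Prop :=
  forall v : 'cV[R]_n, v != 0 -> 0 < (v^T *m Y *m v) 0 0.

Definition siegel (R : realType) (n : nat) (Z : 'M[R[i]]_n) : Prop :=
  exists X Y : 'M[R]_n,
    [/\ X \is symmetricmx, Y \is symmetricmx, real_posdef Y &
        Z = map_mx (real_complex R) X + 'i%C *: map_mx (real_complex R) Y].

(* Main.v *)
Require Import Defs.
From mathcomp Require Import all_boot all_order all_algebra.
From mathcomp Require Import complex.
From mathcomp Require Import reals.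

Import Order.TTheory GRing.Theory Num.Theory.
Local Open Scope ring_scope.
Local Open Scope sesquilinear_scope.

(** Write q(w) = i w^* J w for the Hermitian form attached to J.  A matrix Z is
    recorded by the column space of (Z ; I), its graph, and the Siegel upper
    half space is described by J alone: Z belongs to it if and only if the graph
    is isotropic for the bilinear form of J (which says that Z is symmetric) and
    q is positive on its nonzero vectors, because q (Z v ; v) = 2 v^* (Im Z) v
    for symmetric Z ([siegel_graphP]).

    Both conditions survive the action of S.  The relation S^T J S = J
    preserves isotropic subspaces, and i (S^* J S - J) >= 0 says exactly that
    q (S w) >= q w ([le_sympl_herm_mul]).  Put P = A Z + B and Q = C Z + D, so
    that S (Z ; I) = (P ; Q); then q (P v ; Q v) > 0 for every nonzero v.

    Invertibility of Q is now automatic: q vanishes on vectors of the form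
    (a ; 0), so Q v = 0 is impossible for nonzero v.  Hence the image of the
    graph of Z is the graph of P Q^-1, and it is isotropic and q-positive. *)

(** The factor i makes the skew-Hermitian form w^* J w real valued. *)
Definition sympl_herm {R : realType} {n : nat} (w : 'cV[R[i]]_(n + n)) : R[i] :=
  'i%C * (w ^t* *m symplectic_J R[i] n *m w) 0 0.

Lemma mul_symplectic_J_col (K : pzRingType) (n p : nat) (P Q : 'M[K]_(n, p)) :
  symplectic_J K n *m col_mx P Q = col_mx Q (- P).
Proof.
by rewrite mul_block_col !mul0mx add0r addr0 mul1mx mulNmx mul1mx.
Qed.

Lemma trmxC_mul (C : numClosedFieldType) (m n p : nat)
    (M : 'M[C]_(m, n)) (N : 'M[C]_(n, p)) :
  (M *m N) ^t* = N ^t* *m M ^t*.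
Proof. by rewrite trmx_mul map_mxM. Qed.

(** Isotropy of the column space of (P ; Q) reads P^T Q = Q^T P; dividing by Q
    on both sides turns this into symmetry of P Q^-1. *)
Lemma isotropic_col_mxP (K : fieldType) (n : nat) (P Q : 'M[K]_n) :
  Q \in unitmx ->
  (col_mx P Q)^T *m symplectic_J K n *m col_mx P Q = 0 <->
  (P *m invmx Q)^T = P *m invmx Q.
Proof.
move=> Qu; rewrite -mulmxA mul_symplectic_J_col tr_col_mx mul_row_col mulmxN.
rewrite trmx_mul trmx_inv; split => [/subr0_eq PQ | PQ].
  apply: (canLR (mulKmx _)); first by rewrite unitmx_tr.
  by rewrite mulmxA -PQ mulmxK.
have -> : P^T = Q^T *m (P *m invmx Q) by rewrite -PQ mulKVmx ?unitmx_tr.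
by rewrite -!mulmxA mulVmx // mulmx1 subrr.
Qed.

Lemma sympl_herm_col (R : realType) (n : nat) (a b : 'cV[R[i]]_n) :
  sympl_herm (col_mx a b) = 'i%C * ((a ^t* *m b) 0 0 - (b ^t* *m a) 0 0).
Proof.
rewrite /sympl_herm -mulmxA mul_symplectic_J_col tr_col_mx map_row_mx.
by rewrite mul_row_col mulmxN !mxE.
Qed.

(** The difference of the two sides is the quadratic form of
    i (S^* J S - J) at w. *)
Lemma le_sympl_herm_mul (R : realType) (n : nat) (S : 'M[R[i]]_(n + n))
    (w : 'cV[R[i]]_(n + n)) :
  hermitian_psd
    ('i%C *: (S ^t* *m symplectic_J R[i] n *m S - symplectic_J R[i] n)) ->
  sympl_herm w <= sympl_herm (S *m w).
Proof.
move=> [_ /(_ w)]; congr is_true; rewrite -[RHS]subr_ge0; congr (0 <= _).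
rewrite /sympl_herm -mulrBr -scalemxAr -scalemxAl mxE; congr (_ * _).
by rewrite mulmxBr mulmxBl trmxC_mul !mulmxA !mxE.
Qed.

Lemma symmetricmxP (F : fieldType) (n : nat) (M : 'M[F]_n) :
  M \is symmetricmx <-> M^T = M.
Proof.
split=> [/is_hermitianmxP | MT]; last apply/is_hermitianmxP.
  by rewrite expr0 scale1r map_mx_id.
by rewrite expr0 scale1r map_mx_id.
Qed.

Lemma conj_real_mx (R : realType) (m n : nat) (M : 'M[R]_(m, n)) :
  map_mx Num.conj (map_mx (real_complex R) M) = map_mx (real_complex R) M.
Proof. by apply/matrixP=> i j; rewrite !mxE; exact: conjc_real. Qed.

Lemma complex_mx_ReIm (R : realType) (m n : nat) (M : 'M[R[i]]_(m, n)) :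
  M = map_mx (real_complex R) (map_mx (@complex.Re R) M) +
      'i%C *: map_mx (real_complex R) (map_mx (@complex.Im R) M).
Proof.
apply/matrixP=> i j; rewrite !mxE; exact: complexE.
Qed.

Lemma trmxC_ReIm (R : realType) (m n : nat) (X Y : 'M[R]_(m, n)) :
  (map_mx (real_complex R) X + 'i%C *: map_mx (real_complex R) Y) ^t* =
  map_mx (real_complex R) X^T - 'i%C *: map_mx (real_complex R) Y^T.
Proof.
rewrite linearD linearZ /= map_mxD map_mxZ -!map_trmx !conj_real_mx.
rewrite -scaleNr; congr (_ + _ *: _).
by apply/eqP; rewrite eq_complex /= oppr0 !eqxx.
Qed.

(** The mixed terms i (a^T Y b - b^T Y a) cancel by symmetry of Y.  This is
    what carries positive definiteness of Y from real to complex vectors. *)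
Lemma quad_form_ReIm (R : realType) (n : nat) (Y : 'M[R]_n) (a b : 'cV[R]_n) :
  let v := map_mx (real_complex R) a + 'i%C *: map_mx (real_complex R) b in
  Y^T = Y ->
  (v ^t* *m map_mx (real_complex R) Y *m v) 0 0 =
  ((a^T *m Y *m a) 0 0 + (b^T *m Y *m b) 0 0)%:C%C.
Proof.
move=> v YT.
have cross : b^T *m Y *m a = a^T *m Y *m b.
  (* A 1 x 1 matrix is its own transpose. *)
  rewrite [RHS]mx11_scalar -tr_scalar_mx -mx11_scalar.
  by rewrite !trmx_mul trmxK YT mulmxA.
rewrite /v trmxC_ReIm mulmxBl mulmxDr !mulmxBl -!scalemxAl -!scalemxAr.
rewrite -!map_mxM cross scalerA -expr2 sqr_i scaleN1r.
by rewrite opprK addrA subrK !mxE rmorphD.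
Qed.

(** With symmetric X and Y, q (Z v ; v) = i v^* (Z^* - Z) v and
    Z^* - Z = - 2 i Y. *)
Lemma sympl_herm_graph (R : realType) (n : nat) (X Y : 'M[R]_n)
    (v : 'cV[R[i]]_n) :
  let Z := map_mx (real_complex R) X + 'i%C *: map_mx (real_complex R) Y in
  X^T = X -> Y^T = Y ->
  sympl_herm (col_mx (Z *m v) v) =
  2 * (v ^t* *m map_mx (real_complex R) Y *m v) 0 0.
Proof.
move=> Z XT YT; rewrite sympl_herm_col trmxC_mul trmxC_ReIm XT YT.
set X' := map_mx _ X; set Y' := map_mx _ Y.
have ImZ : X' - 'i%C *: Y' = X' + 'i%C *: Y' + (- 2 * 'i%C) *: Y'.
  by rewrite -addrA -scalerDl mulNr mulr2n mulrDl mul1r opprD addNKr scaleNr.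
rewrite ImZ mulmxDr mulmxDl mulmxA [in LHS]mxE addrAC subrr add0r.
rewrite -scalemxAr -scalemxAl mxE mulrA mulrCA -expr2 sqr_i.
by rewrite mulrN1 opprK.
Qed.

(** Membership in the Siegel upper half space as a property of the graph of Z
    that only involves J, hence one that can be transported by S.  Conversely,
    evaluating q on the graph at real vectors v recovers positivity of Im Z. *)
Lemma siegel_graphP (R : realType) (n : nat) (Z : 'M[R[i]]_n) :
  siegel Z <->
  Z^T = Z /\ forall v, v != 0 -> 0 < sympl_herm (col_mx (Z *m v) v).
Proof.
split=> [[X [Y [/symmetricmxP XT /symmetricmxP YT Ypos ->]]] | [ZT Zpos]].
  split=> [|v v0]; first by rewrite linearD linearZ /= !map_trmx XT YT.
  rewrite sympl_herm_graph // pmulr_rgt0 ?ltr0n //.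
  have Yge (u : 'cV[R]_n) : 0 <= (u^T *m Y *m u) 0 0.
    have [-> | /Ypos/ltW //] := eqVneq u 0.
    by rewrite mulmx0 mxE.
  rewrite [v in X in _ < X]complex_mx_ReIm quad_form_ReIm // ltcR lt_neqAle.
  rewrite addr_ge0 // andbT.
  rewrite eq_sym paddr_eq0 //; apply: contraNN v0 => /andP[re0 im0].
  have Y0 (u : 'cV[R]_n) : (u^T *m Y *m u) 0 0 == 0 -> u = 0.
    by move=> u0; apply/eqP/negPn/negP=> /Ypos; rewrite (eqP u0) ltxx.
  by rewrite [v]complex_mx_ReIm (Y0 _ re0) (Y0 _ im0) !map_mx0 scaler0 addr0.
set X := map_mx (@complex.Re R) Z; set Y := map_mx (@complex.Im R) Z.
have XT : X^T = X by rewrite map_trmx ZT.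
have YT : Y^T = Y by rewrite map_trmx ZT.
exists X, Y; split; [exact/symmetricmxP | exact/symmetricmxP | | ].
  move=> v v0; have := Zpos (map_mx (real_complex R) v).
  rewrite map_mx_eq0 => /(_ v0); rewrite [Z]complex_mx_ReIm sympl_herm_graph //.
  by rewrite pmulr_rgt0 ?ltr0n // -map_trmx conj_real_mx map_trmx -!map_mxM mxE ltcR.
exact: complex_mx_ReIm.
Qed.

Theorem theorem2p3 (R : realType) (n : nat) (n_ge1 : (1 <= n)%N)
    (S : 'M[R[i]]_(n + n)) (A B C D Z : 'M[R[i]]_n)
    (S_blocks : S = block_mx A B C D) (S_sympl : symplectic S)
    (Z_siegel : siegel Z)
    (S_psd : hermitian_psd
       ('i%C *: (S ^t* *m symplectic_J R[i] n *m S - symplectic_J R[i] n))) :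
  C *m Z + D \in unitmx /\
  siegel ((A *m Z + B) *m invmx (C *m Z + D)).
Proof.
set P := A *m Z + B; set Q := C *m Z + D.
have [ZT Zpos] := (siegel_graphP _ _ Z).1 Z_siegel.
have S_graph : S *m col_mx Z 1%:M = col_mx P Q.
  by rewrite S_blocks mul_block_col !mulmx1.
have PQpos (v : 'cV_n) : v != 0 -> 0 < sympl_herm (col_mx (P *m v) (Q *m v)).
  move=> v0; rewrite -mul_col_mx -S_graph -mulmxA.
  apply: lt_le_trans (le_sympl_herm_mul _ _ _ _ S_psd).
  by rewrite mul_col_mx mul1mx Zpos.
have Qu : Q \in unitmx.
  rewrite -unitmx_tr -row_free_unit; apply/inj_row_free => u.
  move/(congr1 trmx); rewrite trmx_mul trmxK trmx0 => Qu0.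
  apply/eqP; rewrite -trmx_eq0; apply/negPn/negP => /PQpos.
  by rewrite Qu0 sympl_herm_col trmx0 map_mx0 mulmx0 mul0mx subrr mulr0 ltxx.
split=> //; apply/siegel_graphP; split.
  (* The graph of Z is isotropic, and S preserves J. *)
  apply/isotropic_col_mxP => //.
  rewrite -S_graph trmx_mul !mulmxA -(mulmxA _ S^T) -(mulmxA _ _ S) S_sympl.
  apply/isotropic_col_mxP; first exact: unitmx1.
  by rewrite invmx1 mulmx1.
(* (P Q^-1 v ; v) = (P u ; Q u) for u = Q^-1 v. *)
move=> v v0; rewrite -{2}(mulKVmx Qu v) -mulmxA; apply: PQpos.
by apply: contraNN v0 => /eqP v0; rewrite -(mulKVmx Qu v) v0 mulmx0.
Qed.
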